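(* Let $E:\mathbb R^d\to\mathbb R$ be twice continuously differentiable, $F=-\nabla E$, $J=-\nabla^2E$, and suppose Assumption A (stated in the context) holds. Fix $T>0$, $k\ge1$, an initial state $x_0\in S^{d-1}$ (the unit sphere of $\mathbb R^d$) and orthonormal vectors $v_{1,0},\dots,v_{k,0}\in\mathbb R^d$ with $v_{i,0}^\top x_0=0$ for $1\le i\le k$. For $N\in\mathbb N$ let $\tau=T/N$ and let $x_n$, $v_{i,n}$ ($1\le n\le N$, $1\le i\le k$) be generated by the discrete constrained HiSD scheme given in the context. Then for $\tau$ small enough, for all $1\le n\le N$ and $1\le i\le k$, $$\frac{x_n-x_{n-1}}{\tau}=\mathcal S^{n-1}-x_{n-1}x_{n-1}^\top F(x_{n-1})+O(\tau),$$ $$\frac{v_{i,n}-v_{i,n-1}}{\tau}=\mathcal R_i^{n-1}+\mathcal L_i^{n-1}-x_{n-1}x_{n-1}^\top J(x_{n-1})v_{i,n-1}+x_{n-1}v_{i,n-1}^\top F(x_{n-1})+O(\tau),$$ where $$\mathcal S^{n-1}=\Big(I-2\sum_{j=1}^k v_{j,n-1}v_{j,n-1}^\top\Big)F(x_{n-1}),\qquad \mathcal R_i^{n-1}=J(x_{n-1})v_{i,n-1},$$ $$\mathcal L_i^{n-1}=\Big(-v_{i,n-1}v_{i,n-1}^\top-2\sum_{j=1}^{i-1}v_{j,n-1}v_{j,n-1}^\top\Big)J(x_{n-1})v_{i,n-1}.$$ Here $O(\tau)$ denotes vectors whose norm is at most $Q\tau$ for all $\tau\le\tau_0$, with $Q,\tau_0>0$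 independent of $\tau$, $n$, $N$ and $i$.
   Context: $\|\cdot\|$ is the Euclidean ($l^2$) norm of a vector, or the induced norm of a matrix; $I$ is the $d\times d$ identity. Assumption A: there is a constant $L>0$ such that for all $x,x_1,x_2\in\mathbb R^d$, $\|J(x_2)-J(x_1)\|+\|F(x_2)-F(x_1)\|\le L\|x_2-x_1\|$ and $\|F(x)\|\le L(1+\|x\|)$. Discrete constrained HiSD scheme (relaxation parameters equal to $1$): for $n=1,\dots,N$, $$\tilde x_n=x_{n-1}+\tau\Big(I-2\sum_{j=1}^k v_{j,n-1}v_{j,n-1}^\top\Big)F(x_{n-1}),\qquad x_n=\frac{\tilde x_n}{\|\tilde x_n\|},$$ $$\tilde v_{i,n}=v_{i,n-1}+\tau J(x_{n-1})v_{i,n-1},\qquad \hat v_{i,n}=\tilde v_{i,n}-(\tilde v_{i,n}^\top x_n)\,x_n,\quad 1\le i\le k,$$ and then, successively for $i=1,\dots,k$ (Gram–Schmidt orthonormalization), $$v_{i,n}=\frac1{Z_{i,n}}\Big(\hat v_{i,n}-\sum_{j=1}^{i-1}(\hat v_{i,n}^\top v_{j,n})v_{j,n}\Big),\qquad Z_{i,n}=\Big\|\hat v_{i,n}-\sum_{j=1}^{i-1}(\hat v_{i,n}^\top v_{j,n})v_{j,n}\Big\|$$ (for $\tau$ sufficiently small $\|\tilde x_n\|\ne0$ and $Z_{i,n}\neq0$). Constants may depend on $E$, $L$, $d$, $k$, $T$ and the initial data. *)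

(* Defs.v *)
From HB Require Import structures.
From mathcomp Require Import all_boot all_order all_algebra.
From mathcomp Require Import all_classical all_reals all_analysis.

Set Implicit Arguments.
Unset Strict Implicit.
Unset Printing Implicit Defensive.

Import Order.TTheory GRing.Theory Num.Theory.
Import numFieldNormedType.Exports.

Local Open Scope classical_set_scope.
Local Open Scope ring_scope.

(* The library norm [`|u|] on matrices is the sup norm, so the Euclidean norm
   and the matrix norm it induces are introduced here.  The topology, hence
   differentiability and continuity, is the same for both. *)

Definition dotv (R : realType) (d : nat) (u w : 'cV[R]_d) : R :=
  (u^T *m w) ord0 ord0.

Definition enorm (R : realType) (d : nat) (u : 'cV[R]_d) : R :=
  Num.sqrt (\sum_(i < d) u i ord0 ^+ 2).

Definition opnorm (R : realType) (d : nat) (A : 'M[R]_d) : R :=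
  sup [set enorm (A *m u) | u in [set u : 'cV[R]_d | enorm u <= 1]].

Definition basis_vec (R : realType) (d : nat) (i : 'I_d) : 'cV[R]_d :=
  delta_mx i ord0.

Definition gradient (R : realType) (d : nat) (E : 'cV[R]_d -> R)
    (x : 'cV[R]_d) : 'cV[R]_d :=
  \col_(i < d) 'D_(basis_vec R i) E x.

Definition hessian (R : realType) (d : nat) (E : 'cV[R]_d -> R)
    (x : 'cV[R]_d) : 'M[R]_d :=
  \matrix_(i < d, j < d)
    'D_(basis_vec R i) (fun y => 'D_(basis_vec R j) E y) x.

(* Continuity of the first derivative is implied by its differentiability. *)
Definition twice_continuously_differentiable (R : realType) (d : nat)
    (E : 'cV[R]_d -> R) : Prop :=
  [/\ forall x, differentiable E x,
      forall x, differentiable (gradient E) x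
    & continuous (hessian E)].

Definition assumptionA (R : realType) (d : nat) (L : R)
    (F : 'cV[R]_d -> 'cV[R]_d) (J : 'cV[R]_d -> 'M[R]_d) : Prop :=
  (forall x1 x2 : 'cV[R]_d,
     opnorm (J x2 - J x1) + enorm (F x2 - F x1) <= L * enorm (x2 - x1)) /\
  (forall x : 'cV[R]_d, enorm (F x) <= L * (1 + enorm x)).

Definition calS (R : realType) (d k : nat) (F : 'cV[R]_d -> 'cV[R]_d)
    (x : 'cV[R]_d) (v : 'I_k -> 'cV[R]_d) : 'cV[R]_d :=
  (1%:M - 2 *: \sum_(j < k) v j *m (v j)^T) *m F x.

Definition calR (R : realType) (d k : nat) (J : 'cV[R]_d -> 'M[R]_d)
    (x : 'cV[R]_d) (v : 'I_k -> 'cV[R]_d) (i : 'I_k) : 'cV[R]_d :=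
  J x *m v i.

Definition calL (R : realType) (d k : nat) (J : 'cV[R]_d -> 'M[R]_d)
    (x : 'cV[R]_d) (v : 'I_k -> 'cV[R]_d) (i : 'I_k) : 'cV[R]_d :=
  (- (v i *m (v i)^T) - 2 *: \sum_(j < k | (j < i)%N) v j *m (v j)^T)
    *m (J x *m v i).

(* One step [(x, v) -> (x', v')] of the scheme.  As [0^-1 = 0], the two
   normalizations are total; the equations determine [x'], then [v' i]
   successively in [i], so every [(x, v)] has exactly one successor and no
   nondegeneracy is assumed. *)
Definition hisd_step (R : realType) (d k : nat)
    (F : 'cV[R]_d -> 'cV[R]_d) (J : 'cV[R]_d -> 'M[R]_d) (tau : R)
    (x : 'cV[R]_d) (v : 'I_k -> 'cV[R]_d)
    (x' : 'cV[R]_d) (v' : 'I_k -> 'cV[R]_d) : Prop :=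
  let xt := x + tau *: ((1%:M - 2 *: \sum_(j < k) v j *m (v j)^T) *m F x) in
  let vt i := v i + tau *: (J x *m v i) in
  let vh i := vt i - dotv (vt i) x' *: x' in
  let w i := vh i - \sum_(j < k | (j < i)%N) dotv (vh i) (v' j) *: v' j in
  x' = (enorm xt)^-1 *: xt /\
  (forall i : 'I_k, v' i = (enorm (w i))^-1 *: w i).

Definition hisd_scheme (R : realType) (d k : nat)
    (F : 'cV[R]_d -> 'cV[R]_d) (J : 'cV[R]_d -> 'M[R]_d) (tau : R) (N : nat)
    (x0 : 'cV[R]_d) (v0 : 'I_k -> 'cV[R]_d)
    (x : nat -> 'cV[R]_d) (v : nat -> 'I_k -> 'cV[R]_d) : Prop :=
  [/\ x 0%N = x0,
      forall i : 'I_k, v 0%N i = v0 i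
    & forall n : nat, (1 <= n <= N)%N ->
        hisd_step F J tau (x n.-1) (v n.-1) (x n) (v n)].

(* Main.v *)
Require Import Defs.
From HB Require Import structures.
From mathcomp Require Import all_boot all_order all_algebra.
From mathcomp Require Import all_classical all_reals all_analysis.
From mathcomp Require Import ring lra.

Set Implicit Arguments.
Unset Strict Implicit.
Unset Printing Implicit Defensive.

Import Order.TTheory GRing.Theory Num.Theory.
Import numFieldNormedType.Exports.

Local Open Scope classical_set_scope.
Local Open Scope ring_scope.

(** The state [(x, v)] stays on the constraint set: [x] is a unit vector and
    [v] an orthonormal family orthogonal to it.  As long as no normalization
    divides by zero, one step preserves these constraints exactly
    ([frame_step]).  It is therefore enough to study a single step from an
    arbitrary constrained state, with bounds uniform in that state; no
    accumulation of errors along the trajectory enters ([uniform_consistency]).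

    A single step composes sums, products, scalar products and normalizations.
    Each quantity has an expansion [a + tau b + O(tau ^ 2)], uniform over all
    constrained states because [F] and [J] are bounded on the unit sphere, and
    such expansions are computed as dual numbers ([jet], [vjet]).  The one
    nonpolynomial rule, for normalization ([vjet_normalize]), removes from [b]
    its component along the unit vector [a]; the leading terms here are unit
    vectors, which also shows that no norm vanishes for small [tau].

    Carried through the scheme, the calculus yields the asserted right-hand
    sides.  Normalizing the trial position subtracts [x x^T F] from [S], as
    [x^T S = x^T F].  Projecting the trial direction against the new position
    produces [- x x^T J v_i + x v_i^T F], the second term because the
    reflection in [S] gives [v_i^T S = - v_i^T F].  In Gram-Schmidt the
    coefficient along [v_j], [j < i], is [v_j^T J v_i + v_i^T J v_j] at first
    order; it equals [2 v_j^T J v_i], as in [L_i], by the symmetry of the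
    Hessian ([hessian_sym]), a consequence of [schwarz]. *)

(** * Symmetry of second derivatives *)

Section Schwarz.
Context {R : realType} {V : normedModType R}.
Implicit Types (f : V -> R) (x u w : V).

Lemma is_derive_line f x u (s : R) : derivable f (x + s *: u) u ->
  is_derive s (1 : R) (fun t : R => f (x + t *: u)) ('D_u f (x + s *: u)).
Proof.
move=> df.
have E : (fun h : R => h^-1 *: (((fun t : R => f (x + t *: u)) \o shift s)
            (h *: (1 : R)) - f (x + s *: u)))
       = (fun h : R => h^-1 *: ((f \o shift (x + s *: u)) (h *: u)
            - f (x + s *: u))).
  apply/funext => h /=; rewrite /shift /= [h *: (1 : R)]mulr1.
  by rewrite scalerDl addrCA addrA.
split; first by rewrite /derivable E.
by rewrite /derive E.
Qed.

(** The mean value theorem is applied twice: first along [u], to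
    [s |-> f (x + h w + s u) - f (x + s u)], then along [w], to the
    difference of [u]-derivatives which that produces. *)
Lemma second_difference f u w x (h : R) : 0 < h ->
  (forall y, derivable f y u) ->
  (forall y, derivable (fun z => 'D_u f z) y w) ->
  exists s t : R, [/\ 0 < s < h, 0 < t < h &
    f (x + h *: w + h *: u) - f (x + h *: u) - (f (x + h *: w) - f x)
    = 'D_w (fun z => 'D_u f z) (x + s *: u + t *: w) * (h * h)].
Proof.
move=> h0 fu fuw.
pose phi s := f (x + h *: w + s *: u) - f (x + s *: u).
have dphi (s : R) : is_derive s (1 : R) phi
    ('D_u f (x + h *: w + s *: u) - 'D_u f (x + s *: u)).
  apply: is_deriveB; exact: is_derive_line.
have [|s sh Es] := MVT h0 (fun s _ => dphi s).
  by apply: continuous_subspaceT => s; apply: differentiable_continuous;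
     apply/derivable1_diffP; apply: (@ex_derive _ _ _ _ _ _ _ (dphi s)).
pose psi t := 'D_u f (x + s *: u + t *: w).
have dpsi (t : R) : is_derive t (1 : R) psi
    ('D_w (fun z => 'D_u f z) (x + s *: u + t *: w)).
  exact: is_derive_line.
have [|t th Et] := MVT h0 (fun s _ => dpsi s).
  by apply: continuous_subspaceT => t; apply: differentiable_continuous;
     apply/derivable1_diffP; apply: (@ex_derive _ _ _ _ _ _ _ (dpsi t)).
exists s, t; split; rewrite -?in_itv//.
move: Es Et; rewrite /phi /psi !scale0r !addr0 !subr0 => -> Et.
by rewrite [RHS]mulrA -Et [x + h *: w + _]addrAC.
Qed.

(** The second difference is symmetric in [u] and [w], so by
    [second_difference] the two mixed derivatives take equal values at two
    points within any prescribed distance of [x]; continuity at [x] then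
    identifies their values there. *)
Lemma schwarz f u w x :
  (forall y, derivable f y u) -> (forall y, derivable f y w) ->
  (forall y, derivable (fun z => 'D_u f z) y w) ->
  (forall y, derivable (fun z => 'D_w f z) y u) ->
  {for x, continuous (fun y => 'D_w (fun z => 'D_u f z) y)} ->
  {for x, continuous (fun y => 'D_u (fun z => 'D_w f z) y)} ->
  'D_w (fun z => 'D_u f z) x = 'D_u (fun z => 'D_w f z) x.
Proof.
move=> fu fw fuw fwu cuw cwu.
apply/eqP; rewrite -subr_eq0 -normr_le0; apply/ler_addgt0Pl => e e0.
rewrite addr0.
have e2 : 0 < e / 2 by rewrite divr_gt0.
have /(_ _ _ e2)/nbhs_ballP[d1 /= d10 H1] := (cvgrPdist_le _ _).1 cuw.
have /(_ _ _ e2)/nbhs_ballP[d2 /= d20 H2] := (cvgrPdist_le _ _).1 cwu.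
pose m := `|u| + `|w| + 1.
have m0 : 0 < m by rewrite ltr_wpDl// addr_ge0.
pose d := Num.min d1 d2.
have d0 : 0 < d by rewrite lt_min d10 d20.
(* Any point x + s u + t w with 0 < s, t < h is then at distance < d of x. *)
have [h h0 hm] : exists2 h, 0 < h & d = h * `|u| + h * `|w| + h.
  exists (d / m); first by rewrite divr_gt0.
  by rewrite -[LHS](divfK (lt0r_neq0 m0)) /m; ring.
have close s t : 0 < s < h -> 0 < t < h -> `|s *: u + t *: w| < d.
  move=> /andP[s0 sh] /andP[t0 th].
  apply: (le_lt_trans (ler_normD _ _)); rewrite !normrZ !gtr0_norm//.
  by rewrite hm ltr_pwDr// lerD// ler_wpM2r// ltW.
have [s [t [hs ht E1]]] := second_difference x h0 fu fuw.
have [t' [s' [ht' hs' E2]]] := second_difference x h0 fw fwu.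
have {E1 E2}E : 'D_w (fun z => 'D_u f z) (x + s *: u + t *: w) =
    'D_u (fun z => 'D_w f z) (x + t' *: w + s' *: u).
  have hh : h * h != 0 by rewrite mulf_neq0// gt_eqF.
  apply: (mulIf hh); apply: etrans (esym E1) _; apply: etrans _ E2.
  rewrite [x + h *: w + h *: u]addrAC.
  move: (f (x + h *: u + h *: w)) (f (x + h *: u)) (f (x + h *: w)) (f x).
  by move=> a b c r; ring.
have B1 : `|'D_w (fun z => 'D_u f z) x -
    'D_w (fun z => 'D_u f z) (x + s *: u + t *: w)| <= e / 2.
  apply: H1; rewrite -ball_normE /ball_ /= -addrA opprD addNKr normrN.
  by apply: lt_le_trans (close _ _ hs ht) _; rewrite ge_min lexx.
have B2 : `|'D_u (fun z => 'D_w f z) x -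
    'D_u (fun z => 'D_w f z) (x + t' *: w + s' *: u)| <= e / 2.
  apply: H2; rewrite -ball_normE /ball_ /= -addrA opprD addNKr normrN addrC.
  by apply: lt_le_trans (close _ _ hs' ht') _; rewrite ge_min lexx orbT.
rewrite E in B1; rewrite distrC in B2.
rewrite [leRHS]splitr; apply: le_trans (lerD B1 B2).
by apply: le_trans (ler_normD _ _); rewrite addrA subrK.
Qed.
End Schwarz.

Section Hessian.
Context {R : realType} {d : nat}.

Lemma hessian_sym (E : 'cV[R]_d -> R) x :
  twice_continuously_differentiable E -> (hessian E x)^T = hessian E x.
Proof.
move=> [dE dG cH]; apply/matrixP => i j; rewrite !mxE.
have fu v y : derivable E y v by apply: diff_derivable.
have fuw a b y : derivable (fun z => 'D_(basis_vec R a) E z) y b.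
  apply: diff_derivable.
  have -> : (fun z => 'D_(basis_vec R a) E z) =
      (fun M : 'cV[R]_d => M a ord0) \o gradient E.
    by apply/funext => z /=; rewrite mxE.
  by apply: differentiable_comp; [exact: dG|exact: differentiable_coord].
have cD a b : {for x, continuous (fun y =>
    'D_(basis_vec R a) (fun z => 'D_(basis_vec R b) E z) y)}.
  have -> : (fun y => 'D_(basis_vec R a) (fun z => 'D_(basis_vec R b) E z) y) =
      (fun M : 'M[R]_d => M a b) \o hessian E.
    by apply/funext => z /=; rewrite mxE.
  by apply: continuous_comp; [exact: cH|exact: coord_continuous].
exact: schwarz.
Qed.
End Hessian.

(** * First-order expansions in the step size *)

Section Jets.
Context {R : realType} {P : Type} (tau : P -> R).

(** The index [p] carries all the data of a step, and only [tau p] tends to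
    [0]: bounds that hold near this filter are therefore uniform in the
    remaining data. *)
Definition vanishing : set_system P :=
  [set A | exists2 e, 0 < e & forall p, tau p <= e -> A p].

Global Instance vanishing_filter : Filter vanishing.
Proof.
apply: Build_Filter.
- by exists 1.
- move=> A B [e e0 He] [e' e'0 He'].
  exists (Num.min e e'); first by rewrite lt_min e0.
  by move=> p; rewrite le_min => /andP[h h']; split; [exact: He|exact: He'].
- by move=> A B AB [e e0 He]; exists e => // p /He; exact: AB.
Qed.

Lemma vanishing_le (e : R) : 0 < e -> \forall p \near vanishing, tau p <= e.
Proof. by move=> e0; exists e. Qed.

(** [f = O(tau ^ n)], uniformly in the data carried by [p]. *)
Definition bigo (n : nat) (f : P -> R) :=
  exists2 C, 0 < C & \forall p \near vanishing, `|f p| <= C * tau p ^+ n.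

(** [f = a + tau b + O(tau ^ 2)].  The coefficients [a] and [b] are themselves
    functions of the data, required to be bounded so that expansions can be
    multiplied as dual numbers. *)
Definition jet (f a b : P -> R) :=
  [/\ bigo 0 a, bigo 0 b & bigo 2 (fun p => f p - (a p + tau p * b p))].

Hypothesis tau_gt0 : forall p, 0 < tau p.

Lemma bigo_bounded C (f : P -> R) : (forall p, `|f p| <= C) -> bigo 0 f.
Proof.
move=> fC; exists (`|C| + 1); first by rewrite ltr_wpDl.
apply: nearW => p; rewrite expr0 mulr1 (le_trans (fC p))//.
by rewrite (le_trans (ler_norm _))// lerDl.
Qed.

Lemma bigo_tau : bigo 1 tau.
Proof. by exists 1 => //; apply: nearW => p; rewrite expr1 mul1r gtr0_norm. Qed.

Lemma bigoD n f g : bigo n f -> bigo n g -> bigo n (fun p => f p + g p).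
Proof.
move=> [C C0 hC] [D D0 hD]; exists (C + D); first exact: addr_gt0.
near=> p; rewrite mulrDl (le_trans (ler_normD _ _))// lerD//.
- by near: p.
- by near: p.
Unshelve. all: by end_near. Qed.

Lemma bigoN n f : bigo n f -> bigo n (fun p => - f p).
Proof.
move=> [C C0 hC]; exists C => //.
by apply: filterS hC => p; rewrite normrN.
Qed.

Lemma bigoM m n f g : bigo m f -> bigo n g -> bigo (m + n) (fun p => f p * g p).
Proof.
move=> [C C0 hC] [D D0 hD]; exists (C * D); first exact: mulr_gt0.
near=> p; rewrite exprD mulrACA normrM ler_pM//.
- by near: p.
- by near: p.
Unshelve. all: by end_near. Qed.

Lemma bigoW m n f : (m <= n)%N -> bigo n f -> bigo m f.
Proof.
move=> mn [C C0 hC]; exists C => //; near=> p.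
apply: (@le_trans _ _ (C * tau p ^+ n)); first by near: p.
rewrite ler_pM2l// ler_wiXn2l//; first exact/ltW/tau_gt0.
by near: p; exact: vanishing_le.
Unshelve. all: by end_near. Qed.

Lemma eq_bigo n f g : (forall p, f p = g p) -> bigo n f -> bigo n g.
Proof. by move=> /funext ->. Qed.

Lemma bigo_sum n (I : Type) (r : seq I) (f : I -> P -> R) :
  (forall i, bigo n (f i)) -> bigo n (fun p => \sum_(i <- r) f i p).
Proof.
move=> H; elim: r => [|i r IH].
  exists 1 => //; apply: nearW => p.
  by rewrite big_nil normr0 mul1r exprn_ge0// ltW.
by apply: eq_bigo (bigoD (H i) IH) => p; rewrite big_cons.
Qed.

Lemma eq_jet f a b f' a' b' : (forall p, f p = f' p) ->
  (forall p, a p = a' p) -> (forall p, b p = b' p) ->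
  jet f a b -> jet f' a' b'.
Proof. by move=> /funext -> /funext -> /funext ->. Qed.

Lemma jet_bounded f a b : jet f a b -> bigo 0 f.
Proof.
move=> [ha hb hf].
apply: (@eq_bigo _ (fun p => f p - (a p + tau p * b p) + (a p + tau p * b p))).
  by move=> p; rewrite subrK.
apply: bigoD; first exact: bigoW hf.
apply: bigoD => //; apply: (@bigoW _ 1) => //.
exact: (bigoM bigo_tau hb).
Qed.

Lemma jet_const f : bigo 0 f -> jet f f (fun=> 0).
Proof.
move=> hf; split=> //; first by apply: (@bigo_bounded 0) => p; rewrite normr0.
exists 1 => //; apply: nearW => p.
by rewrite mulr0 addr0 subrr normr0 mul1r exprn_ge0// ltW.
Qed.

Lemma jet_tau f : bigo 0 f -> jet (fun p => tau p * f p) (fun=> 0) f.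
Proof.
move=> hf; split=> //; first by apply: (@bigo_bounded 0) => p; rewrite normr0.
exists 1 => //; apply: nearW => p.
by rewrite add0r subrr normr0 mul1r exprn_ge0// ltW.
Qed.

Lemma jetD f a b g a' b' : jet f a b -> jet g a' b' ->
  jet (fun p => f p + g p) (fun p => a p + a' p) (fun p => b p + b' p).
Proof.
move=> [ha hb hf] [ha' hb' hg]; split; [exact: bigoD|exact: bigoD|].
apply: eq_bigo (bigoD hf hg) => p; ring.
Qed.

Lemma jetN f a b : jet f a b ->
  jet (fun p => - f p) (fun p => - a p) (fun p => - b p).
Proof.
move=> [ha hb hf]; split; [exact: bigoN|exact: bigoN|].
apply: eq_bigo (bigoN hf) => p; ring.
Qed.

Lemma jetM f a b g a' b' : jet f a b -> jet g a' b' ->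
  jet (fun p => f p * g p) (fun p => a p * a' p)
      (fun p => a p * b' p + b p * a' p).
Proof.
move=> hf hg; have bg := jet_bounded hg.
case: hf => ha hb hf; case: hg => ha' hb' hg.
split; [exact: (bigoM ha ha')| |].
  by apply: bigoD; [exact: (bigoM ha hb')|exact: (bigoM hb ha')].
have bt : bigo 0 (fun p => a p + tau p * b p).
  apply: bigoD => //; apply: (@bigoW _ 1) => //; exact: (bigoM bigo_tau hb).
have h2 : bigo 2 (fun p => tau p * tau p * (b p * b' p)).
  exact: (bigoM (bigoM bigo_tau bigo_tau) (bigoM hb hb')).
apply: eq_bigo (bigoD (bigoD (bigoM hf bg) (bigoM bt hg)) h2) => p; ring.
Qed.

Lemma jet_sum (I : Type) (r : seq I) (Q : pred I) (f a b : I -> P -> R) :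
  (forall i, Q i -> jet (f i) (a i) (b i)) ->
  jet (fun p => \sum_(i <- r | Q i) f i p) (fun p => \sum_(i <- r | Q i) a i p)
      (fun p => \sum_(i <- r | Q i) b i p).
Proof.
move=> H; elim: r => [|i r IH].
  have b0 : bigo 0 (fun=> 0) by apply: (@bigo_bounded 0) => p; rewrite normr0.
  by apply: eq_jet (jet_const b0) => p; rewrite big_nil.
case: (boolP (Q i)) => Qi; last first.
  by apply: eq_jet IH => p; rewrite big_cons (negbTE Qi).
by apply: eq_jet (jetD (H i Qi) IH) => p; rewrite big_cons Qi.
Qed.

(** The bound is kept as a square because it is used under a square root. *)
Lemma jet_near1 f b : jet f (fun=> 1) b ->
  \forall p \near vanishing, 2^-1 ^+ 2 <= f p.
Proof.
move=> [_ hb hf].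
have [C C0 hC] : bigo 1 (fun p => f p - 1).
  apply: eq_bigo (bigoD (bigoW (leqnSn 1) hf) (bigoM bigo_tau hb)) => p; ring.
near=> p.
have h1 : `|f p - 1| <= C * tau p ^+ 1 by near: p.
have h2 : tau p <= C^-1 / 2.
  by near: p; apply: vanishing_le; rewrite divr_gt0// invr_gt0.
have h3 : C * tau p ^+ 1 <= 2^-1.
  by rewrite expr1 -(ler_pM2l (_ : 0 < C^-1)) ?invr_gt0// mulKf ?gt_eqF.
have := le_trans h1 h3; rewrite ler_norml => /andP[]; lra.
Unshelve. all: by end_near. Qed.

(** With [s = sqrt f], the error of the expansion of [1 / s] to first order in
    [f - 1 = s ^ 2 - 1] is exactly [(f - 1) ^ 2] times a factor that is at most
    [2] as soon as [1 / 2 <= s]. *)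
Lemma jet_invsqrt f b : jet f (fun=> 1) b ->
  jet (fun p => (Num.sqrt (f p))^-1) (fun=> 1) (fun p => - (b p / 2)).
Proof.
move=> jf; have f1 := jet_near1 jf; case: jf => h1 hb hf.
have hb2 : bigo 0 (fun p => b p / 2).
  by apply: (bigoM hb (@bigo_bounded 2^-1 _ _)) => p; rewrite ger0_norm.
split; [exact: h1|exact: bigoN|].
have hd : bigo 1 (fun p => f p - 1).
  apply: eq_bigo (bigoD (bigoW (leqnSn 1) hf) (bigoM bigo_tau hb)) => p; ring.
have h2 : bigo 2 (fun p => (Num.sqrt (f p))^-1 - 1 + (f p - 1) / 2).
  have [C C0 hC] := bigoM hd hd.
  exists (2 * C); first exact: mulr_gt0.
  near=> p.
  have fp : 2^-1 ^+ 2 <= f p by near: p.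
  have Cp : `|(f p - 1) * (f p - 1)| <= C * tau p ^+ (1 + 1) by near: p.
  rewrite -mulrA; apply: le_trans (ler_wpM2l _ Cp); last by [].
  set s := Num.sqrt (f p).
  have s2 : 2^-1 <= s.
    by rewrite -[leLHS]ger0_norm// -sqrtr_sqr ler_sqrt// (le_trans _ fp).
  have -> : f p = s ^+ 2 by rewrite sqr_sqrtr// (le_trans _ fp).
  have -> : s^-1 - 1 + (s ^+ 2 - 1) / 2 =
      (s + 2) / (2 * s * (s + 1) ^+ 2) * ((s ^+ 2 - 1) * (s ^+ 2 - 1)).
    by field; apply/andP; split; rewrite gt_eqF//; lra.
  rewrite normrM ler_wpM2r// ger0_norm; last first.
    by rewrite divr_ge0 ?mulr_ge0 ?exprn_ge0//; lra.
  rewrite ler_pdivrMr; last by rewrite !mulr_gt0 ?exprn_gt0//; lra.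
  nra.
have h3 : bigo 2 (fun p => (f p - (1 + tau p * b p)) / 2).
  by apply: (bigoM hf (@bigo_bounded 2^-1 _ _)) => p; rewrite ger0_norm.
apply: eq_bigo (bigoD h2 (bigoN h3)) => p; ring.
Unshelve. all: by end_near. Qed.

End Jets.

(** * Euclidean scalar product and norm *)

Section Euclid.
Context {R : realType} {d : nat}.
Implicit Types (u v w z : 'cV[R]_d) (A : 'M[R]_d).

Lemma dotvE u v : dotv u v = \sum_i u i ord0 * v i ord0.
Proof. by rewrite /dotv mxE; apply: eq_bigr => i _; rewrite mxE. Qed.

Lemma dotvC u v : dotv u v = dotv v u.
Proof. by rewrite !dotvE; apply: eq_bigr => i _; rewrite mulrC. Qed.

Lemma dotvDr u v w : dotv u (v + w) = dotv u v + dotv u w.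
Proof. by rewrite /dotv mulmxDr mxE. Qed.

Lemma dotvNr u v : dotv u (- v) = - dotv u v.
Proof. by rewrite /dotv mulmxN mxE. Qed.

Lemma dotvZr (a : R) u v : dotv u (a *: v) = a * dotv u v.
Proof. by rewrite /dotv -scalemxAr mxE. Qed.

Lemma dotv_sumr (I : Type) (r : seq I) (Q : pred I) u (f : I -> 'cV[R]_d) :
  dotv u (\sum_(i <- r | Q i) f i) = \sum_(i <- r | Q i) dotv u (f i).
Proof. by rewrite /dotv mulmx_sumr summxE. Qed.

Lemma dotvDl u v w : dotv (v + w) u = dotv v u + dotv w u.
Proof. by rewrite !(dotvC _ u) dotvDr. Qed.

Lemma dotvNl u v : dotv (- v) u = - dotv v u.
Proof. by rewrite !(dotvC _ u) dotvNr. Qed.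

Lemma dotvZl (a : R) u v : dotv (a *: v) u = a * dotv v u.
Proof. by rewrite !(dotvC _ u) dotvZr. Qed.

Lemma dotv_suml (I : Type) (r : seq I) (Q : pred I) u (f : I -> 'cV[R]_d) :
  dotv (\sum_(i <- r | Q i) f i) u = \sum_(i <- r | Q i) dotv (f i) u.
Proof. by rewrite dotvC dotv_sumr; apply: eq_bigr => i _; rewrite dotvC. Qed.

Lemma dotv_sym_mx A u v : A^T = A -> dotv u (A *m v) = dotv v (A *m u).
Proof.
by move=> sA; rewrite dotvC {1}/dotv trmx_mul sA -mulmxA.
Qed.

Lemma outer_mulmx u v w : (u *m v^T) *m w = dotv v w *: u.
Proof.
rewrite -mulmxA [v^T *m w]mx11_scalar mul_mx_scalar /dotv.
by congr (_ *: _); congr (_ _ _); apply/val_inj.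
Qed.

Lemma enormE u : enorm u = Num.sqrt (dotv u u).
Proof. by rewrite /enorm dotvE; congr Num.sqrt. Qed.

Lemma enorm_ge0 u : 0 <= enorm u.
Proof. exact: sqrtr_ge0. Qed.

Lemma dotvv_ge0 u : 0 <= dotv u u.
Proof. by rewrite dotvE sumr_ge0// => i _; rewrite -expr2 sqr_ge0. Qed.

Lemma sqr_enorm u : enorm u ^+ 2 = dotv u u.
Proof. by rewrite enormE sqr_sqrtr// dotvv_ge0. Qed.

Lemma enorm1P u : enorm u = 1 <-> dotv u u = 1.
Proof.
split=> [u1|u1]; first by rewrite -sqr_enorm u1 expr1n.
by rewrite enormE u1 sqrtr1.
Qed.

Lemma enorm_normalize u : enorm u != 0 ->
  dotv ((enorm u)^-1 *: u) ((enorm u)^-1 *: u) = 1.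
Proof. by move=> u0; rewrite dotvZl dotvZr -sqr_enorm; field. Qed.

Lemma coord_le_enorm u i : `|u i ord0| <= enorm u.
Proof.
rewrite -sqrtr_sqr /enorm ler_sqrt; last first.
  by apply: sumr_ge0 => j _; rewrite sqr_ge0.
by rewrite (bigD1 i)//= lerDl sumr_ge0// => j _; rewrite sqr_ge0.
Qed.

Lemma enorm_le_sum u : enorm u <= \sum_i `|u i ord0|.
Proof.
have s0 : 0 <= \sum_i `|u i ord0| by apply: sumr_ge0.
rewrite -[leRHS]ger0_norm// -sqrtr_sqr ler_sqrt ?sqr_ge0//.
rewrite [leRHS]expr2 mulr_suml; apply: ler_sum => i _.
rewrite -real_normK ?num_real// expr2 ler_wpM2l//.
by rewrite (bigD1 i)//= lerDl sumr_ge0.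
Qed.

Lemma enorm_basis_vec j : enorm (basis_vec R j : 'cV[R]_d) = 1.
Proof.
apply/enorm1P; rewrite dotvE (bigD1 j)//= big1 ?addr0.
  by rewrite !mxE !eqxx mulr1.
by move=> i ij; rewrite !mxE (negbTE ij) mul0r.
Qed.

(** [A i j] is a coordinate of the image of a basis vector.  The supremum
    defining [opnorm] is an upper bound only because its set is bounded, here by
    the sum of all [`|A a b|]. *)
Lemma coord_le_opnorm A i j : `|A i j| <= opnorm A.
Proof.
pose B := \sum_a \sum_b `|A a b|.
have ub : has_ubound
    [set enorm (A *m u) | u in [set u : 'cV[R]_d | enorm u <= 1]].
  exists B => _ [u /= u1 <-].
  apply: le_trans (enorm_le_sum _) _; apply: ler_sum => a _.
  rewrite mxE; apply: le_trans (ler_norm_sum _ _ _) _.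
  apply: ler_sum => b _; rewrite normrM ler_piMr//.
  exact: le_trans (coord_le_enorm _ _) u1.
apply: (@le_trans _ _ (enorm (A *m basis_vec R j))); last first.
  by apply: (ub_le_sup ub); exists (basis_vec R j) => //=;
    rewrite enorm_basis_vec.
apply: le_trans (coord_le_enorm _ i).
rewrite mxE (bigD1 j)//= big1 ?addr0 => [|b bj].
  by rewrite mxE !eqxx mulr1.
by rewrite mxE (negbTE bj) mulr0.
Qed.
End Euclid.

(** * First-order expansions of vectors *)

Section VJets.
Context {R : realType} {P : Type} (tau : P -> R) {d : nat}.
Hypothesis tau_gt0 : forall p, 0 < tau p.

Definition vjet (f a b : P -> 'cV[R]_d) := forall i,
  jet tau (fun p => f p i ord0) (fun p => a p i ord0) (fun p => b p i ord0).

Lemma eq_vjet f a b f' a' b' : (forall p, f p = f' p) ->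
  (forall p, a p = a' p) -> (forall p, b p = b' p) ->
  vjet f a b -> vjet f' a' b'.
Proof. by move=> /funext -> /funext -> /funext ->. Qed.

Lemma vjet_const (f : P -> 'cV[R]_d) C :
  (forall p, enorm (f p) <= C) -> vjet f f (fun=> 0).
Proof.
move=> fC i.
apply: eq_jet (jet_const tau_gt0 (bigo_bounded (C := C) _ _)) => p //.
  by rewrite mxE.
exact: le_trans (coord_le_enorm _ _) _.
Qed.

Lemma vjet_tau (f : P -> 'cV[R]_d) C :
  (forall p, enorm (f p) <= C) -> vjet (fun p => tau p *: f p) (fun=> 0) f.
Proof.
move=> fC i; apply: eq_jet (jet_tau tau_gt0 (bigo_bounded (C := C) _ _)) => p //.
- by rewrite mxE.
- by rewrite mxE.
- exact: le_trans (coord_le_enorm _ _) _.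
Qed.

Lemma vjetD f a b g a' b' : vjet f a b -> vjet g a' b' ->
  vjet (fun p => f p + g p) (fun p => a p + a' p) (fun p => b p + b' p).
Proof. by move=> hf hg i; apply: eq_jet (jetD (hf i) (hg i)) => p; rewrite mxE. Qed.

Lemma vjetN f a b : vjet f a b ->
  vjet (fun p => - f p) (fun p => - a p) (fun p => - b p).
Proof. by move=> hf i; apply: eq_jet (jetN (hf i)) => p; rewrite mxE. Qed.

Lemma vjetZ (c c0 c1 : P -> R) f a b : jet tau c c0 c1 -> vjet f a b ->
  vjet (fun p => c p *: f p) (fun p => c0 p *: a p)
       (fun p => c0 p *: b p + c1 p *: a p).
Proof.
by move=> hc hf i; apply: eq_jet (jetM tau_gt0 hc (hf i)) => p; rewrite !mxE.
Qed.

Lemma vjet_sum (I : Type) (r : seq I) (Q : pred I) (f a b : I -> P -> 'cV[R]_d) :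
  (forall i, Q i -> vjet (f i) (a i) (b i)) ->
  vjet (fun p => \sum_(i <- r | Q i) f i p) (fun p => \sum_(i <- r | Q i) a i p)
       (fun p => \sum_(i <- r | Q i) b i p).
Proof.
move=> H j; apply: eq_jet (jet_sum tau_gt0 r (fun i Qi => H i Qi j)) => p;
  by rewrite summxE.
Qed.

Lemma jet_dotv f a b g a' b' : vjet f a b -> vjet g a' b' ->
  jet tau (fun p => dotv (f p) (g p)) (fun p => dotv (a p) (a' p))
      (fun p => dotv (a p) (b' p) + dotv (b p) (a' p)).
Proof.
move=> hf hg.
apply: eq_jet (jet_sum tau_gt0 (index_enum 'I_d) (Q := predT)
  (fun i _ => jetM tau_gt0 (hf i) (hg i))) => p; rewrite !dotvE//.
by rewrite -big_split.
Qed.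

(** Around a unit vector [a], normalizing removes from the first-order term its
    component along [a]. *)
Lemma vjet_normalize f a b : vjet f a b -> (forall p, dotv (a p) (a p) = 1) ->
  vjet (fun p => (enorm (f p))^-1 *: f p) a
       (fun p => b p - dotv (a p) (b p) *: a p).
Proof.
move=> hf a1.
have hn : jet tau (fun p => dotv (f p) (f p)) (fun=> 1)
    (fun p => 2 * dotv (a p) (b p)).
  apply: eq_jet (jet_dotv hf hf) => p //; rewrite (dotvC (b p)); ring.
apply: eq_vjet (vjetZ (jet_invsqrt tau_gt0 hn) hf) => p.
- by rewrite enormE.
- by rewrite scale1r.
- by rewrite scale1r [2 * _ / 2]mulrAC divff// mul1r scaleNr.
Qed.

(** Nondegeneracy for small [tau]: the leading term is a unit vector. *)
Lemma vjet_near_neq0 f a b : vjet f a b -> (forall p, dotv (a p) (a p) = 1) ->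
  \forall p \near vanishing tau, enorm (f p) != 0.
Proof.
move=> hf a1.
have hn : jet tau (fun p => dotv (f p) (f p)) (fun=> 1)
    (fun p => dotv (a p) (b p) + dotv (b p) (a p)).
  by apply: eq_jet (jet_dotv hf hf).
apply: filterS (jet_near1 tau_gt0 hn) => p; apply: contraTneq => f0.
by rewrite -sqr_enorm f0 expr0n /= -ltNge exprn_gt0.
Qed.

(** The remainder [O(tau ^ 2)], known coordinate by coordinate, is summed into
    a bound on the Euclidean norm and divided by [tau]. *)
Lemma vjet_rate f a b : vjet f a b -> exists2 Q, 0 < Q &
  \forall p \near vanishing tau,
    enorm ((tau p)^-1 *: (f p - a p) - b p) <= Q * tau p.
Proof.
move=> hf.
have {hf}[Q Q0 HQ] : exists2 Q, 0 < Q & \forall p \near vanishing tau,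
    \sum_i `|(f p - (a p + tau p *: b p)) i ord0| <= Q * tau p ^+ 2.
  have [C C0 hC] : bigo tau 2
      (fun p => \sum_i `|(f p - (a p + tau p *: b p)) i ord0|).
    apply: bigo_sum => // i; have [_ _ [C C0 hC]] := hf i.
    by exists C => //; apply: filterS hC => p; rewrite normr_id !mxE.
  by exists C => //; apply: filterS hC => p; apply: le_trans; exact: ler_norm.
exists Q => //; apply: filterS HQ => p HQ.
have t0 := tau_gt0 p.
have -> : (tau p)^-1 *: (f p - a p) - b p =
    (tau p)^-1 *: (f p - (a p + tau p *: b p)).
  by rewrite opprD addrA [in RHS]scalerBr scalerA mulVf ?gt_eqF// scale1r.
apply: le_trans (enorm_le_sum _) _.
rewrite (eq_bigr (fun i => (tau p)^-1 *
    `|(f p - (a p + tau p *: b p)) i ord0|)); last first.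
  by move=> i _; rewrite mxE normrM gtr0_norm// invr_gt0.
rewrite -mulr_sumr ler_pdivrMl//; apply: le_trans HQ _.
by rewrite expr2 mulrCA.
Qed.
End VJets.

(** * One step of the scheme *)

Section Scheme.
Context {R : realType} {d k : nat}.
Variables (F : 'cV[R]_d -> 'cV[R]_d) (J : 'cV[R]_d -> 'M[R]_d).
Implicit Types (x : 'cV[R]_d) (v : 'I_k -> 'cV[R]_d).

(** The constraint set, on which the consistency expansions hold. *)
Definition frame x v := [/\ enorm x = 1,
  forall i j, dotv (v i) (v j) = (i == j)%:R & forall i, dotv (v i) x = 0].

Lemma gtn_ord_eqF (i j : 'I_k) : (j < i)%N -> (i == j) = false.
Proof. by move=> ji; apply/negbTE; rewrite -val_eqE /= gtn_eqF. Qed.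

Lemma calSE x v :
  calS F x v = F x - 2 *: \sum_j dotv (v j) (F x) *: v j.
Proof.
rewrite /calS mulmxBl mul1mx -scalemxAl mulmx_suml.
by under eq_bigr do rewrite outer_mulmx.
Qed.

Lemma calLE x v i : calL J x v i =
  - (dotv (v i) (J x *m v i) *: v i)
  - 2 *: \sum_(j < k | (j < i)%N) dotv (v j) (J x *m v i) *: v j.
Proof.
rewrite /calL mulmxBl mulNmx outer_mulmx -scalemxAl mulmx_suml.
by under eq_bigr do rewrite outer_mulmx.
Qed.

(** The intermediate vectors of one step with step size [t]: the positions
    before normalization, the directions after the explicit step, after the
    projection orthogonal to [x'], and after the subtraction of the components
    along the previous directions. *)
Definition trial_x (t : R) x v := x + t *: calS F x v.
Definition trial_v (t : R) x v i := v i + t *: (J x *m v i).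
Definition tangent_v (t : R) x v x' i :=
  trial_v t x v i - dotv (trial_v t x v i) x' *: x'.
Definition ortho_v (t : R) x v x' v' i := tangent_v t x v x' i -
  \sum_(j < k | (j < i)%N) dotv (tangent_v t x v x' i) (v' j) *: v' j.

(** The constraints are preserved exactly, not only up to an error in the step
    size: the projection makes every candidate orthogonal to [x'], and
    Gram-Schmidt does the rest, by strong induction on the index. *)
Lemma frame_step t x v x' v' : hisd_step F J t x v x' v' ->
  enorm (trial_x t x v) != 0 -> (forall i, enorm (ortho_v t x v x' v' i) != 0) ->
  frame x' v'.
Proof.
move=> [Ex Ev] nx nv.
have {Ex}Ex : x' = (enorm (trial_x t x v))^-1 *: trial_x t x v by [].
have {}Ev i : v' i = (enorm (ortho_v t x v x' v' i))^-1 *: ortho_v t x v x' v' i.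
  exact: Ev.
have x1 : dotv x' x' = 1 by rewrite Ex enorm_normalize.
have v1 i : dotv (v' i) (v' i) = 1 by rewrite Ev enorm_normalize.
have tx i : dotv (tangent_v t x v x' i) x' = 0.
  by rewrite /tangent_v dotvDl dotvNl dotvZl x1 mulr1 subrr.
have vx i : dotv (v' i) x' = 0.
  have [n] := ubnP (i : nat); elim: n i => // n IH i; rewrite ltnS => lin.
  rewrite Ev dotvZl [X in _ * X](_ : _ = 0) ?mulr0// /ortho_v.
  rewrite dotvDl tx dotvNl dotv_suml big1 ?oppr0 ?addr0// => j ji.
  by rewrite dotvZl IH ?mulr0// (leq_trans ji).
have vv (i j : 'I_k) : (j < i)%N -> dotv (v' i) (v' j) = 0.
  have [n] := ubnP (i : nat); elim: n i j => // n IH i j; rewrite ltnS => lin ji.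
  rewrite Ev dotvZl [X in _ * X](_ : _ = 0) ?mulr0// /ortho_v.
  rewrite dotvDl dotvNl dotv_suml (bigD1 j)//= big1 => [|l /andP[li lj]].
    by rewrite dotvZl v1 mulr1 addr0 subrr.
  rewrite dotvZl; have [lj'|jl|ljE] := ltngtP l j.
  - by rewrite [dotv (v' l) _]dotvC (IH j) ?mulr0// (leq_trans ji).
  - by rewrite (IH l) ?mulr0// (leq_trans li).
  - by case/eqP: lj; exact: val_inj.
split=> //; first exact/enorm1P.
move=> i j; have [->|ij] := eqVneq i j; first exact: v1.
have [ltij|ltji|ijE] := ltngtP i j.
- by rewrite dotvC vv.
- by rewrite vv.
- by case/eqP: ij; exact: val_inj.
Qed.

(** The data over which the estimates are uniform: every step size and every
    point of the constraint set, with the outcome of one step.  Bundling the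
    hypotheses with the data makes the expansions below unconditional. *)
Record framed_step := FramedStep {
  stau : R; sx : 'cV[R]_d; sv : 'I_k -> 'cV[R]_d;
  sx' : 'cV[R]_d; sv' : 'I_k -> 'cV[R]_d;
  stau_gt0 : 0 < stau;
  sframe : frame sx sv;
  sstep : hisd_step F J stau sx sv sx' sv' }.

Variables (CF CJ : R).
Hypothesis F_le : forall x, enorm x = 1 -> enorm (F x) <= CF.
Hypothesis J_le : forall x i j, enorm x = 1 -> `|J x i j| <= CJ.
Hypothesis J_sym : forall x, (J x)^T = J x.

(** The right-hand sides of the continuous constrained dynamics. *)
Definition rate_x x v := calS F x v - x *m x^T *m F x.
Definition rate_v x v i := calR J x v i + calL J x v i
  - x *m x^T *m J x *m v i + x *m (v i)^T *m F x.

(** The first-order motion of the [i]-th direction before Gram-Schmidt.  Its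
    second term keeps the direction orthogonal to the moving point. *)
Definition rate_tangent x v i :=
  J x *m v i - (dotv x (J x *m v i) - dotv (v i) (F x)) *: x.

Lemma rate_vE x v i : rate_v x v i = rate_tangent x v i + calL J x v i.
Proof.
rewrite /rate_v /rate_tangent /calR -[_ *m J x *m v i]mulmxA !outer_mulmx.
rewrite scalerBl opprB -!addrA; congr (_ + _).
by rewrite [RHS]addrA [RHS]addrC; congr (_ + _); rewrite addrC.
Qed.

(** For orthonormal [v_j], the matrix [I - 2 sum_j v_j v_j^T] is a reflection,
    hence an isometry. *)
Lemma enorm_calS x v : frame x v -> enorm (calS F x v) = enorm (F x).
Proof.
move=> [_ vv _]; rewrite !enormE; congr Num.sqrt.
rewrite calSE; set PF := \sum_j _.
have PFF : dotv PF PF = dotv PF (F x).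
  rewrite {1 3}/PF !dotv_suml.
  apply: eq_bigr => j _; rewrite !dotvZl dotv_sumr (bigD1 j)//=.
  rewrite big1 ?addr0 => [|l lj]; first by rewrite dotvZr vv eqxx mulr1.
  by rewrite dotvZr vv eq_sym (negbTE lj) mulr0.
rewrite dotvDl !dotvDr !dotvNl !dotvNr !dotvZl !dotvZr PFF (dotvC (F x) PF).
ring.
Qed.

Lemma vjet_trial_x :
  vjet stau (fun p => trial_x (stau p) (sx p) (sv p)) sx
    (fun p => calS F (sx p) (sv p)).
Proof.
apply: eq_vjet (vjetD (vjet_const stau_gt0 (C := 1) _)
  (vjet_tau stau_gt0 (C := CF) _)) => p //=.
- by rewrite addr0.
- by rewrite add0r.
- by have [-> _ _] := sframe p.
- by rewrite (enorm_calS (sframe p)) F_le//; case: (sframe p).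
Qed.

Lemma vjet_x : vjet stau sx' sx (fun p => rate_x (sx p) (sv p)).
Proof.
have x1 (p : framed_step) : dotv (sx p) (sx p) = 1.
  by case: (sframe p) => /enorm1P.
apply: eq_vjet (vjet_normalize stau_gt0 vjet_trial_x x1) => p //.
  by have [-> _] := sstep p.
rewrite /rate_x outer_mulmx; congr (_ - _ *: _).
rewrite calSE dotvDr dotvNr dotvZr dotv_sumr big1 ?mulr0 ?subr0// => j _.
by have [_ _ vx] := sframe p; rewrite dotvZr [dotv (sx p) _]dotvC vx mulr0.
Qed.

(** The reflection reverses the components of the force along the frame. *)
Lemma dotv_rate_x x v i : frame x v ->
  dotv (v i) (rate_x x v) = - dotv (v i) (F x).
Proof.
move=> [_ vv vx]; rewrite /rate_x outer_mulmx dotvDr dotvNr dotvZr vx mulr0 subr0.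
rewrite calSE dotvDr dotvNr dotvZr dotv_sumr (bigD1 i)//= big1 => [|j ji].
  by rewrite dotvZr vv eqxx mulr1; ring.
by rewrite dotvZr vv eq_sym (negbTE ji) mulr0.
Qed.

Lemma enorm_Jv x v i : frame x v ->
  enorm (J x *m v i) <= \sum_(a < d) \sum_(b < d) CJ.
Proof.
move=> [x1 vv _]; apply: le_trans (enorm_le_sum _) _; apply: ler_sum => a _.
rewrite mxE; apply: le_trans (ler_norm_sum _ _ _) _; apply: ler_sum => b _.
rewrite normrM; apply: (@le_trans _ _ `|J x a b|); last exact: J_le.
rewrite ler_piMr//; apply: le_trans (coord_le_enorm _ _) _.
by have -> : enorm (v i) = 1 by apply/enorm1P; rewrite vv eqxx.
Qed.

Lemma vjet_tangent i :
  vjet stau (fun p => tangent_v (stau p) (sx p) (sv p) (sx' p) i)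
    (fun p => sv p i) (fun p => rate_tangent (sx p) (sv p) i).
Proof.
have jt : vjet stau (fun p => trial_v (stau p) (sx p) (sv p) i)
    (fun p => sv p i) (fun p => J (sx p) *m sv p i).
  apply: eq_vjet (vjetD (vjet_const stau_gt0 (C := 1) _)
    (vjet_tau stau_gt0 (C := \sum_(a < d) \sum_(b < d) CJ) _)) => p //=.
  - by rewrite addr0.
  - by rewrite add0r.
  - by have [_ vv _] := sframe p; rewrite (_ : enorm _ = 1)//;
      apply/enorm1P; rewrite vv eqxx.
  - exact: enorm_Jv (sframe p).
apply: eq_vjet (vjetD jt (vjetN
  (vjetZ stau_gt0 (jet_dotv stau_gt0 jt vjet_x) vjet_x))) => p //.
- by case: (sframe p) => _ _ vx; rewrite vx scale0r subr0.
- case: (sframe p) => _ _ vx.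
  rewrite vx scale0r add0r /rate_tangent dotv_rate_x; last exact: sframe.
  by congr (_ - _ *: _); rewrite (dotvC (J _ *m _)) addrC.
Qed.

Lemma dotv_rate_tangent x v i j : frame x v ->
  dotv (v j) (rate_tangent x v i) = dotv (v j) (J x *m v i).
Proof.
by move=> [_ _ vx]; rewrite dotvDr dotvNr dotvZr vx mulr0 subr0.
Qed.

(** [calL J x v j] lies in the span of the [v l] with [l <= j]. *)
Lemma dotv_calL_lt x v (i j : 'I_k) : frame x v ->
  (j < i)%N -> dotv (v i) (calL J x v j) = 0.
Proof.
move=> [_ vv _] ji; rewrite calLE dotvDr !dotvNr !dotvZr dotv_sumr.
rewrite vv (gtn_ord_eqF ji) mulr0 oppr0 add0r big1 ?mulr0 ?oppr0// => l lj.
by rewrite dotvZr vv (gtn_ord_eqF (ltn_trans lj ji)) mulr0.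
Qed.

Definition rate_ortho x v (i : 'I_k) := rate_tangent x v i
  - 2 *: \sum_(j < k | (j < i)%N) dotv (v j) (J x *m v i) *: v j.

(** Expanding [dotv (tangent_v i) (v' j)] gives at first order two
    contributions, [v_j . J v_i] from the motion of the [i]-th direction and
    [v_i . J v_j] from that of the [j]-th one.  The symmetry of [J] makes them
    equal; this is the origin of the factor [2] in [calL]. *)
Lemma vjet_ortho (i : 'I_k) :
  (forall j : 'I_k, (j < i)%N -> vjet stau (fun p => sv' p j) (fun p => sv p j)
     (fun p => rate_v (sx p) (sv p) j)) ->
  vjet stau (fun p => ortho_v (stau p) (sx p) (sv p) (sx' p) (sv' p) i)
    (fun p => sv p i) (fun p => rate_ortho (sx p) (sv p) i).
Proof.
move=> H.
apply: eq_vjet (vjetD (vjet_tangent i) (vjetN (vjet_sum stau_gt0 (index_enum 'I_k)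
  (fun j (ji : (j < i)%N) => vjetZ stau_gt0
     (jet_dotv stau_gt0 (vjet_tangent i) (H j ji)) (H j ji))))) => p //.
  have [_ vv _] := sframe p; rewrite big1 ?subr0// => j ji.
  by rewrite vv (gtn_ord_eqF ji) scale0r.
congr (_ - _); rewrite scaler_sumr; apply: eq_bigr => j ji.
have fr := sframe p; have [_ vv _] := fr.
rewrite vv (gtn_ord_eqF ji).
rewrite scale0r add0r scalerA; congr (_ *: _).
rewrite rate_vE dotvDr dotv_calL_lt// addr0 dotv_rate_tangent//.
rewrite dotvC (dotvC (rate_tangent _ _ _)) dotv_rate_tangent//.
by rewrite dotvC dotv_sym_mx//; ring.
Qed.

Lemma dotv_rate_ortho x v i : frame x v ->
  dotv (v i) (rate_ortho x v i) = dotv (v i) (J x *m v i).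
Proof.
move=> fr; rewrite dotvDr dotv_rate_tangent// dotvNr dotvZr dotv_sumr.
rewrite big1 ?mulr0 ?subr0// => j ji; have [_ vv _] := fr.
by rewrite dotvZr vv (gtn_ord_eqF ji) mulr0.
Qed.

(** Strong induction on [i], since the [i]-th Gram-Schmidt step uses the
    expansions of the earlier ones.  The last normalization removes the
    component of the motion along [v_i] itself, which is the term of [calL]
    without the factor [2]. *)
Lemma vjet_v i : vjet stau (fun p => sv' p i) (fun p => sv p i)
  (fun p => rate_v (sx p) (sv p) i).
Proof.
have [n] := ubnP (i : nat); elim: n i => // n IH i; rewrite ltnS => lin.
have v1 (p : framed_step) : dotv (sv p i) (sv p i) = 1.
  by have [_ -> _] := sframe p; rewrite eqxx.
have jo := vjet_ortho (fun j ji => IH j (leq_trans ji lin)).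
apply: eq_vjet (vjet_normalize stau_gt0 jo v1) => p //.
  by have [_ ->] := sstep p.
rewrite dotv_rate_ortho; last exact: sframe.
by rewrite rate_vE calLE /rate_ortho -addrA; congr (_ + _); rewrite addrC.
Qed.

Lemma near_frame : \forall p \near vanishing stau, frame (sx' p) (sv' p).
Proof.
have nx : \forall p \near vanishing stau,
    enorm (trial_x (stau p) (sx p) (sv p)) != 0.
  apply: (vjet_near_neq0 stau_gt0 vjet_trial_x) => p.
  by case: (sframe p) => /enorm1P.
have nv : \forall p \near vanishing stau, forall i,
    enorm (ortho_v (stau p) (sx p) (sv p) (sx' p) (sv' p) i) != 0.
  apply: filter_forall => i.
  apply: (vjet_near_neq0 stau_gt0 (vjet_ortho (fun j _ => vjet_v j))) => p.
  by have [_ -> _] := sframe p; rewrite eqxx.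
by apply: filterS2 nx nv => p; exact: frame_step (sstep p).
Qed.

(** The finitely many expansions share one constant and one threshold.  The
    conclusion that the constraints persist lets the bounds be used at the
    next step, with the same constants. *)
Lemma uniform_consistency : exists Q tau0 : R, [/\ 0 < Q, 0 < tau0 &
  forall p : framed_step, stau p <= tau0 ->
  [/\ frame (sx' p) (sv' p),
      enorm ((stau p)^-1 *: (sx' p - sx p) - rate_x (sx p) (sv p)) <= Q * stau p
    & forall i, enorm ((stau p)^-1 *: (sv' p i - sv p i)
        - rate_v (sx p) (sv p) i) <= Q * stau p]].
Proof.
have [Qx Qx0 hx] := vjet_rate stau_gt0 vjet_x.
have /choice[Qv hQv] : forall i, exists Q, 0 < Q /\
    \forall p \near vanishing stau,
      enorm ((stau p)^-1 *: (sv' p i - sv p i) - rate_v (sx p) (sv p) i)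
      <= Q * stau p.
  by move=> i; have [Q Q0 hQ] := vjet_rate stau_gt0 (vjet_v i); exists Q.
have sv0 : 0 <= \sum_i Qv i.
  by apply: sumr_ge0 => i _; rewrite ltW//; case: (hQv i).
have hv : \forall p \near vanishing stau, forall i,
    enorm ((stau p)^-1 *: (sv' p i - sv p i) - rate_v (sx p) (sv p) i)
    <= Qv i * stau p.
  by apply: filter_forall => i; case: (hQv i).
have [e e0 he] := filterI near_frame (filterI hx hv).
exists (Qx + \sum_i Qv i), e; split => //; first by rewrite ltr_wpDr.
move=> p /he[fr [px pv]]; split => //.
  by apply: le_trans px _; rewrite ler_pM2r ?stau_gt0// lerDl.
move=> i; apply: le_trans (pv i) _; rewrite ler_pM2r ?stau_gt0//.
rewrite (bigD1 i)//= addrCA lerDl addr_ge0 ?(ltW Qx0)// sumr_ge0// => j _.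
by rewrite ltW//; case: (hQv j).
Qed.

End Scheme.

(** * Consistency along the trajectory *)

Theorem theorem4p1 (R : realType) (d k : nat) (E : 'cV[R]_d -> R)
    (F : 'cV[R]_d -> 'cV[R]_d) (J : 'cV[R]_d -> 'M[R]_d) (L T : R)
    (x0 : 'cV[R]_d) (v0 : 'I_k -> 'cV[R]_d)
    (hE : twice_continuously_differentiable E)
    (hF : forall x, F x = - gradient E x)
    (hJ : forall x, J x = - hessian E x)
    (hL : 0 < L) (hA : assumptionA L F J)
    (hT : 0 < T) (hk : (1 <= k)%N)
    (hx0 : enorm x0 = 1)
    (hv0 : forall i j : 'I_k, dotv (v0 i) (v0 j) = (i == j)%:R)
    (hv0x0 : forall i : 'I_k, dotv (v0 i) x0 = 0) :
  exists Q tau0 : R, [/\ 0 < Q, 0 < tau0 &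
    forall (N : nat) (tau : R) (x : nat -> 'cV[R]_d)
        (v : nat -> 'I_k -> 'cV[R]_d),
      (0 < N)%N -> tau = T / N%:R -> tau <= tau0 ->
      hisd_scheme F J tau N x0 v0 x v ->
      forall (n : nat) (i : 'I_k), (1 <= n <= N)%N ->
        let y := x n.-1 in
        let u := v n.-1 in
        enorm (tau^-1 *: (x n - y)
               - (calS F y u - y *m y^T *m F y)) <= Q * tau /\
        enorm (tau^-1 *: (v n i - u i)
               - (calR J y u i + calL J y u i
                  - y *m y^T *m J y *m u i
                  + y *m (u i)^T *m F y)) <= Q * tau].
Proof.
have [hlip hgrow] := hA.
have F_le x : enorm x = 1 -> enorm (F x) <= L * 2.
  by move=> x1; have := hgrow x; rewrite x1.
have J_le x a b : enorm x = 1 -> `|J x a b| <= L + opnorm (J 0).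
  (* The origin is at distance 1 from every point of the unit sphere. *)
  move=> x1; rewrite -[J x](subrK (J 0)) mxE.
  apply: le_trans (ler_normD _ _) _.
  apply: lerD; last exact: coord_le_opnorm.
  apply: le_trans (coord_le_opnorm _ _ _) _.
  have := hlip 0 x; rewrite subr0 x1 mulr1.
  by apply: le_trans; rewrite lerDl enorm_ge0.
have J_sym x : (J x)^T = J x by rewrite hJ linearN /= hessian_sym.
have [Q [tau0 [Q0 tau00 H]]] := uniform_consistency (k := k) F_le J_le J_sym.
exists Q, tau0; split=> // N tau x v N0 Etau tau_le [Ex0 Ev0 Hstep].
have tau_gt0 : 0 < tau by rewrite Etau divr_gt0 ?ltr0n.
have Hframe n : (n <= N)%N -> frame (x n) (v n).
  elim: n => [_|n IH nN].
    by split=> [|a b|a]; rewrite ?Ex0 ?Ev0.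
  by case: (H (FramedStep tau_gt0 (IH (ltnW nN)) (Hstep n.+1 nN)) tau_le).
move=> n i /[dup] hn /andP[n0 nN] y u.
have nN' : (n.-1 <= N)%N by rewrite (leq_trans (leq_pred _)).
by have [_ hx /(_ i) hv] :=
  H (FramedStep tau_gt0 (Hframe _ nN') (Hstep n hn)) tau_le.
Qed.
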